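(* Let $B\ge 2$ be an integer with exactly $m\ge 1$ distinct prime factors. Then, for each integer $n\ge 2$, there are at most $2^m-2$ and at least $2^{m-1}-1$ positive integers $x$ with exactly $n$ digits in base $B$ such that $$x^2\equiv x\pmod{B^n}.$$ For $n=1$, there are exactly $2^m-1$ positive integers $x$ with exactly one digit in base $B$ such that $x^2\equiv x\pmod{B}$.
   Context: A positive integer $x$ has exactly $n$ digits in base $B$ if its $n$-th base-$B$ digit from the right is its leftmost digit and is non-zero, i.e. $B^{n-1}\le x<B^n$. *)

(* Defs.v *)
From mathcomp Require Import all_boot.

Set Implicit Arguments.
Unset Strict Implicit.
Unset Printing Implicit Defensive.

Definition exact_digits (B n x : nat) : bool := B ^ n.-1 <= x < B ^ n.

(* Every x with exactly n base-B digits is below B ^ n, so letting x range over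
   'I_(B ^ n) loses none of the positive integers to be counted. *)
Definition idempotents (B n : nat) : {set 'I_(B ^ n)} :=
  [set x : 'I_(B ^ n) |
    [&& 0 < x, exact_digits B n x & x ^ 2 == x %[mod B ^ n]]].

(* Main.v *)
Require Import Defs.
From mathcomp Require Import all_boot.
From mathcomp Require Import zify.

(** An idempotent modulo [N] is congruent to 0 or 1 modulo each prime-power
    component of [N], hence is determined by the set of primes dividing it, and
    every set of primes dividing [N] arises by the Chinese remainder theorem:
    there are [2 ^ m] idempotents.  For [n >= 2] the idempotents 0 and 1 have too few
    digits, and [x |-> B ^ n + 1 - x] sends each other idempotent with too few
    digits to one with exactly [n] digits, so at least half of the remaining
    [2 ^ m - 2] have exactly [n] digits. *)

Definition modular_idempotents (N : nat) : {set 'I_N} :=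
  [set x : 'I_N | (x ^ 2 == x %[mod N])].

Lemma sqrn_eq_mod (N x : nat) : (x ^ 2 == x %[mod N]) = (N %| x * x.-1).
Proof.
case: x => [|x]; first by rewrite mul0n dvdn0 eqxx.
by rewrite eqn_mod_dvd ?leq_pmulr // -mulnn -{3}[x.+1]muln1 -mulnBr subn1.
Qed.

(** Since [x] and [x - 1] are coprime, [p] cannot divide both, so the whole [p]-part of [N] falls on
    one factor. The conjunct [0 < x] makes [x.-1] a true predecessor, so that the second case means
    [x] is 1 modulo that part. *)
Lemma dvdn_idempotent_part {N x p : nat} :
  p \in primes N -> N %| x * x.-1 ->
  if p %| x then N`_p %| x else (0 < x) && (N`_p %| x.-1).
Proof.
rewrite mem_primes => /and3P[p_pr N_gt0 _] /(dvdn_trans (dvdn_part p N)).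
rewrite p_part; case: ifPn => [p_x|pNx].
  case: x p_x => [|x] p_x; first by rewrite dvdn0.
  by rewrite /= Gauss_dvdl // coprimeXl // (coprime_dvdl p_x) // coprimeSn.
have x_gt0 : 0 < x by case: x pNx => //; rewrite dvdn0.
by rewrite x_gt0 Gauss_dvdr // coprimeXl // prime_coprime.
Qed.

Lemma eqn_mod_partsP (N x y : nat) : 0 < N ->
  (forall p, p \in primes N -> x = y %[mod N`_p]) -> x = y %[mod N].
Proof.
move=> N_gt0; wlog le_yx : x y / y <= x => [wl|] eq_xy.
  case/orP: (leq_total y x) => [|le_xy]; first by move/wl; apply.
  by apply/esym/wl => // p /eq_xy.
apply/eqP; rewrite eqn_mod_dvd //; apply/dvdn_partP => // p p_N.
by rewrite -eqn_mod_dvd //; apply/eqP/eq_xy.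
Qed.

Lemma modular_idempotents_inj (N x y : nat) : 0 < N ->
    x ^ 2 = x %[mod N] -> y ^ 2 = y %[mod N] ->
    (forall p, p \in primes N -> (p %| x) = (p %| y)) ->
  x = y %[mod N].
Proof.
move=> N_gt0 /eqP; rewrite sqrn_eq_mod => x_idem /eqP.
rewrite sqrn_eq_mod => y_idem eq_dv; apply: eqn_mod_partsP => // p p_N.
move: (dvdn_idempotent_part p_N x_idem) (dvdn_idempotent_part p_N y_idem).
rewrite (eq_dv p p_N); case: ifP => _; first by rewrite /dvdn => /eqP-> /eqP->.
case: x y {x_idem y_idem eq_dv} => [|x] [|y] //= /eqP x0 /eqP y0.
by rewrite -addn1 -[y.+1]addn1 -modnDml x0 -[in RHS]modnDml y0.
Qed.

Lemma modular_idempotent_exists (N : nat) (pi : nat_pred) : 0 < N ->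
  exists x, [/\ x < N, x ^ 2 = x %[mod N] &
    forall p, p \in primes N -> (p %| x) = (p \in pi)].
Proof.
move=> N_gt0; have cop := coprime_partC pi N N.
(* Being 0 modulo the [pi]-part and 1 modulo the complementary part makes [N] divide [x * x.-1]. *)
pose x := chinese N`_pi N`_pi^' 0 1 %% N.
have N_part := partnC pi N_gt0.
have x0 : N`_pi %| x.
  by rewrite /dvdn /x modn_dvdm ?dvdn_part // chinese_modl // mod0n.
have x1 : x = 1 %[mod N`_pi^'].
  by rewrite /x modn_dvdm ?dvdn_part // chinese_modr.
exists x; split.
- by rewrite ltn_mod.
- apply/eqP; rewrite sqrn_eq_mod -[X in X %| _]N_part dvdn_mul //.
  case: (posnP x) => [->|x_gt0]; first exact: dvdn0.
  by rewrite -subn1 -eqn_mod_dvd //; apply/eqP.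
- move=> p p_N; have p_part_dvd (rho : nat_pred) : p \in rho -> p %| N`_rho.
    move=> p_rho; have : p \in primes N`_rho.
      by rewrite primes_part mem_filter p_rho.
    by rewrite mem_primes => /and3P[].
  apply/idP/idP => [p_x|p_pi]; last exact: dvdn_trans (p_part_dvd _ p_pi) x0.
  apply: contraT => p_pi; have p_d : p %| N`_pi^' by exact: p_part_dvd.
  (* Reducing [x1] modulo [p] would give 0 = 1 modulo a prime. *)
  have := congr1 (modn^~ p) x1.
  rewrite /= (modn_dvdm x) // (modn_dvdm 1) // (eqP p_x).
  by move: p_N; rewrite mem_primes => /andP[/prime_gt1/modn_small->].
Qed.

Lemma card_modular_idempotents (N : nat) : 0 < N ->
  #|modular_idempotents N| = 2 ^ size (primes N).
Proof.
(* The bound is [N.+1] because [N] may itself be prime. *)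
move=> N_gt0; pose P := [set p : 'I_N.+1 | val p \in primes N].
have ltP p : p \in primes N -> p < N.+1.
  by rewrite mem_primes ltnS => /and3P[_ _ /dvdn_leq->].
have cardP : #|P| = size (primes N).
  rewrite cardE -(size_map val); apply: perm_size; apply: uniq_perm.
  - by rewrite map_inj_uniq ?enum_uniq //; apply: val_inj.
  - exact: primes_uniq.
  move=> p; apply/mapP/idP => [[q]|p_N]; first by rewrite mem_enum inE => ? ->.
  by exists (Ordinal (ltP p p_N)); rewrite // mem_enum inE.
(* Two injections: [f] sends an idempotent to its prime divisors in [P]; [g] picks an idempotent for
   each subset of [P], which is recovered from its prime divisors. *)
rewrite -cardP -card_powerset; apply/eqP; rewrite eqn_leq; apply/andP; split.
  pose f (x : 'I_N) := [set p in P | val p %| x].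
  rewrite -(card_in_imset (f := f)); last first.
    move=> x y; rewrite !inE => /eqP x_idem /eqP y_idem eq_f; apply: val_inj.
    rewrite /= -(modn_small (ltn_ord x)) -(modn_small (ltn_ord y)).
    apply: modular_idempotents_inj => // p p_N.
    by have /setP/(_ (Ordinal (ltP p p_N))) := eq_f; rewrite !inE /= p_N.
  apply/subset_leq_card/subsetP => _ /imsetP[x _ ->].
  by rewrite inE; apply/subsetP => p; rewrite inE => /andP[].
have exg (A : {set 'I_N.+1}) : exists x : 'I_N,
    (x \in modular_idempotents N) &&
    [forall p in P, (val p %| x) == (p \in A)].
  have [x [ltxN /eqP x_idem xA]] :=
    modular_idempotent_exists N [pred p | inord p \in A] N_gt0.
  exists (Ordinal ltxN); rewrite inE x_idem; apply/forall_inP => p.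
  by rewrite inE => /xA /= ->; rewrite inE inord_val.
pose g A := xchoose (exg A).
rewrite -(card_in_imset (f := g)); last first.
  move=> A C; rewrite !inE => /subsetP sAP /subsetP sCP eq_g.
  apply/setP => p; have [p_P|pNP] := boolP (p \in P); last first.
    by rewrite (contraNF (sAP p)) ?(contraNF (sCP p)).
  case/andP: (xchooseP (exg A)) => _ /forall_inP/(_ p p_P)/eqP<-.
  case/andP: (xchooseP (exg C)) => _ /forall_inP/(_ p p_P)/eqP<-.
  by rewrite -/(g A) -/(g C) eq_g.
apply/subset_leq_card/subsetP => _ /imsetP[A _ ->].
by case/andP: (xchooseP (exg A)).
Qed.

(** Modulo [N] this is [1 - x]: the substitution swaps the factors of [x * (x - 1)] up to sign. *)
Lemma modular_idempotent_compl (N x : nat) : 0 < x <= N ->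
  x ^ 2 = x %[mod N] -> (N.+1 - x) ^ 2 = N.+1 - x %[mod N].
Proof.
case/andP=> x_gt0 le_xN /eqP; rewrite sqrn_eq_mod => x_idem.
apply/eqP; rewrite sqrn_eq_mod.
have -> : (N.+1 - x).-1 = N - x by lia.
have -> : (N.+1 - x) = N - x.-1 by lia.
have le_x1N : x.-1 <= N by lia.
rewrite mulnBr dvdn_subr ?leq_mul2l ?le_xN ?orbT ?(dvdn_mull _ (dvdnn N)) //.
rewrite mulnBl dvdn_subr ?leq_mul2r ?le_x1N ?orbT ?(dvdn_mulr _ (dvdnn N)) //.
by rewrite mulnC.
Qed.

Theorem theorem5 (B m : nat) (hB : 2 <= B) (hm : 1 <= m)
    (hBm : size (primes B) = m) :
  (forall n : nat, 2 <= n ->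
     #|idempotents B n| <= 2 ^ m - 2 /\ 2 ^ m.-1 - 1 <= #|idempotents B n|) /\
  #|idempotents B 1| = 2 ^ m - 1.
Proof.
have cardI n : 0 < n -> #|modular_idempotents (B ^ n)| = 2 ^ m.
  move=> n_gt0; rewrite card_modular_idempotents ?primesX ?hBm //.
  by rewrite expn_gt0 ltnW.
split=> [n n_ge2|]; last first.
  have B1_gt0 : 0 < B ^ 1 by rewrite expn1; lia.
  (* For [n = 1] the lower digit bound is [B ^ 0 = 1], so only the idempotent 0 is lost. *)
  rewrite -(cardI 1 isT) (cardsD1 (Ordinal B1_gt0) (modular_idempotents _)).
  rewrite inE eqxx add1n subn1 /=.
  apply: eq_card => x; rewrite !inE /exact_digits expn0 -val_eqE /= -lt0n.
  by rewrite ltn_ord; case: (0 < _).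
set N := B ^ n; pose E := idempotents B n.
have N_Bn : N = B * B ^ n.-1 by rewrite -expnS prednK //; lia.
have Bn1_gt1 : 1 < B ^ n.-1.
  by rewrite (leq_trans hB) // -{1}[B]expn1 leq_exp2l //; lia.
have two_Bn : 2 * B ^ n.-1 <= N by rewrite N_Bn leq_mul2r hB orbT.
have N_gt0 : 0 < N by lia.
have N_gt1 : 1 < N by lia.
pose x0 := Ordinal N_gt0; pose x1 := Ordinal N_gt1.
pose T := modular_idempotents N :\ x0 :\ x1.
have cardT : #|T| = 2 ^ m - 2.
  have := cardI n (ltnW n_ge2).
  rewrite -/N (cardsD1 x0) (cardsD1 x1) -/T !inE /= => <-.
  by rewrite !eqxx !add1n subn2.
have sET : E \subset T.
  apply/subsetP => x; rewrite !inE -!val_eqE /=.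
  case/and3P=> x_gt0 /andP[le_x _] ->.
  by rewrite (gtn_eqF (leq_trans Bn1_gt1 le_x)) (gtn_eqF x_gt0).
split; first by rewrite -cardT subset_leq_card.
(* The value 0 is a filler making [c] total; members of [T] are at least 2. *)
have lt_compl (x : 'I_N) : (if x < 2 then 0 else N.+1 - x) < N.
  by case: (ltnP x 2) => x_ge2; lia.
pose c x := Ordinal (lt_compl x).
have cardTE : #|T :\: E| <= #|E|.
  rewrite -(card_in_imset (f := c)) => [|x y]; last first.
    rewrite !inE -!val_eqE /= => /and4P[_ ? ? _] /and4P[_ ? ? _].
    move/(congr1 val) => /= eq_c; apply: val_inj.
    by move: eq_c (ltn_ord x) (ltn_ord y) => /=; case: ifP; case: ifP; lia.
  (* If [x < B ^ n.-1], then [N.+1 - x] exceeds [N - B ^ n.-1], which is at least [B ^ n.-1] by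
     [two_Bn]. *)
  apply/subset_leq_card/subsetP => _ /imsetP[x + ->].
  rewrite !inE -!val_eqE /= => /and4P[xNE xN1 xN0 x_idem].
  have x_ge2 : (x < 2) = false by lia.
  have ltxN := ltn_ord x.
  move: xNE; rewrite x_ge2 x_idem /exact_digits -/N ltxN !andbT => xNE.
  apply/and3P; split; [lia|lia|].
  by apply/eqP/modular_idempotent_compl; [lia | apply/eqP].
(* [T] splits into [E] and [T :\: E], so [2 ^ m - 2] is at most twice [#|E|]. *)
have := cardsID E T; rewrite (setIidPr sET) cardT -/E => cardE.
have two_m : 2 ^ m = 2 * 2 ^ m.-1 by rewrite -expnS prednK.
rewrite -/E; move: cardE cardTE two_m.
by move: #|E| #|T :\: E| (2 ^ m) (2 ^ m.-1); lia.
Qed.
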